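(* Let $s:\mathbb{C}\to\mathbb{C}$ be a holomorphic map. Then there are two families of complete holomorphic vector fields on $\mathbb{C}^2$, which are tangent to $\mathrm{graph}(s)$ and analytically equivalent, by a fiber-preserving automorphism of $\mathbb{C}^2$ that takes $\mathrm{graph}(s)$ into the line $\{t=0\}$, to one of the polynomial vector fields below. That is, for every polynomial vector field $X_1$ of the form (i) or (ii) there is a complete holomorphic vector field on $\mathbb{C}^2$, tangent to $\mathrm{graph}(s)$, which is sent to $X_1$ by such an automorphism: (i) $$X_1=(ax+b)\frac{\partial}{\partial x}+A(x)\,t\,\frac{\partial}{\partial t},$$ where $a,b\in\mathbb{C}$, $A\in\mathbb{C}[x]$, $A\not\equiv0$; or (ii) $$X_1=a\,t\,\frac{\partial}{\partial t}+A(x^mt^n)\cdot\left(nx\frac{\partial}{\partial x}-mt\frac{\partial}{\partial t}\right),$$ where $a\in\mathbb{C}$, $m,n\in\mathbb{N}^+$, $\gcd(m,n)=1$, $A\in\mathbb{C}[y]$, $A\not\equiv0$ (evaluated at $y=x^mt^n$).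
   Context: $\mathrm{graph}(s)=\{(z,s(z)):z\in\mathbb{C}\}\subset\mathbb{C}^2$; coordinates on the source $\mathbb{C}^2$ are $(z,w)$ and on the target $(x,t)$. $\mathbb{N}^+$ denotes the positive integers. A vector field is tangent to a curve $C$ if $X(p)\in T_pC$ at each smooth point $p$ of $C$ ($X(p)=0$ allowed). A holomorphic vector field is complete if its solutions are defined for all complex times. An automorphism of $\mathbb{C}^2$ (biholomorphism of $\mathbb{C}^2$) is fiber-preserving if it maps vertical lines (first coordinate constant) to vertical lines. Two vector fields are analytically equivalent if one is the push-forward of the other under an analytic automorphism. *)

(* Defs.v *)
From HB Require Import structures.
From mathcomp Require Import all_boot all_order all_algebra.
From mathcomp Require Import complex.
From mathcomp Require Import all_classical all_reals all_analysis.

Set Implicit Arguments.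
Unset Strict Implicit.
Unset Printing Implicit Defensive.

Import Order.TTheory GRing.Theory Num.Theory.
Import numFieldNormedType.Exports.

Local Open Scope classical_set_scope.
Local Open Scope ring_scope.

(* The field of complex numbers is R[i] for R : realType.  All derivatives below have R[i] as scalar field, so
   differentiability is complex (Frechet) differentiability. *)

(* The library gives R[i] its field structure and modulus but no topology keyed
   on R[i]; it is the one of the regular module: balls for the modulus. *)
HB.instance Definition _ (R : rcfType) := NormedModule.copy R[i] (R[i]^o).

Definition holomorphic (R : realType) (V W : normedModType R[i])
  (f : V -> W) : Prop := forall p, differentiable f p.

Section Plane.
Variable R : realType.
Local Notation C := R[i].
Local Notation C2 := (C * C)%type.

(* A vector field  u d/dx + v d/dt  on C^2 is the map p |-> (u p, v p). *)
Definition vector_field : Type := C2 -> C2.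

(* The time is complex.  For holomorphic X the solution through a point is
   unique where it exists, so this says that every maximal solution is entire. *)
Definition complete_vf (X : vector_field) : Prop :=
  forall p : C2, exists phi : C -> C2,
    phi 0 = p /\ forall tau : C, is_derive tau 1 phi (X (phi tau)).

Definition graph_of (s : C -> C) : set C2 := [set p | p.2 = s p.1].

(* f is a holomorphic equation of D near p with df_p <> 0: near p, the set D is
   the one-dimensional complex submanifold {f = 0}. *)
Definition regular_equation (D : set C2) (p : C2) (f : C2 -> C) : Prop :=
  [/\ D p,
      \forall q \near p, differentiable f q,
      exists v : C2, 'd f p v != 0 &
      \forall q \near p, D q <-> f q = 0].

Definition smooth_point (D : set C2) (p : C2) : Prop :=
  exists f, regular_equation D p f.

(* ker df_p does not depend on the chosen regular equation f. *)
Definition tangent_space (D : set C2) (p : C2) : set C2 :=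
  [set v | exists f, regular_equation D p f /\ 'd f p v = 0].

Definition tangent_to (X : vector_field) (D : set C2) : Prop :=
  forall p, smooth_point D p -> tangent_space D p (X p).

Record automorphism : Type := Automorphism {
  aut_fun :> C2 -> C2;
  aut_inv : C2 -> C2;
  aut_fun_holo : holomorphic aut_fun;
  aut_inv_holo : holomorphic aut_inv;
  aut_funK : cancel aut_fun aut_inv;
  aut_invK : cancel aut_inv aut_fun
}.

Definition vf_pushforward (Phi : automorphism) (X : vector_field) : vector_field :=
  fun q => 'd Phi (aut_inv Phi q) (X (aut_inv Phi q)).

Definition vertical_line (z : C) : set C2 := [set p | p.1 = z].

Definition fiber_preserving (Phi : automorphism) : Prop :=
  forall z, exists x, aut_fun Phi @` vertical_line z = vertical_line x.

Definition field_i (a b : C) (A : {poly C}) : vector_field :=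
  fun p => let: (x, t) := p in (a * x + b, A.[x] * t).

Definition field_ii (a : C) (m n : nat) (A : {poly C}) : vector_field :=
  fun p => let: (x, t) := p in
    let c := A.[x ^+ m * t ^+ n] in
    (c * (n%:R * x), a * t - c * (m%:R * t)).

Definition family_i : set vector_field :=
  [set X1 | exists (a b : C) (A : {poly C}), A != 0 /\ X1 = field_i a b A].

Definition family_ii : set vector_field :=
  [set X1 | exists (a : C) (m n : nat) (A : {poly C}),
     [/\ (0 < m)%N, (0 < n)%N, coprime m n, A != 0 & X1 = field_ii a m n A]].

End Plane.

(* Main.v *)
(* The automorphism Phi (z, w) = (z, w - s z) straightens graph(s) to {t = 0}, and
   X is the pull-back of X1 by Phi.  Completeness transfers from X1, whose flow is
   explicit, and tangency holds because X1 is tangent to {t = 0}.  The second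
   component of X involves s', so the point is that the derivative of an entire
   function is entire.  This is obtained from Goursat's theorem for rectangles
   applied to w |-> f (z + e^w) e^(-w), which gives
     f'(z) = (1 / 2 pi) * integral over [0, 2 pi] of f (z + e^(it)) e^(-it) dt. *)
Require Import Defs.
From HB Require Import structures.
From mathcomp Require Import all_boot all_order all_algebra.
From mathcomp Require Import complex.
From mathcomp Require Import all_classical all_reals all_analysis.
From mathcomp Require Import ring lra.

Set Implicit Arguments.
Unset Strict Implicit.
Unset Printing Implicit Defensive.

Import Order.TTheory GRing.Theory Num.Theory.
Import numFieldNormedType.Exports.

Local Open Scope classical_set_scope.
Local Open Scope ring_scope.
Local Open Scope complex_scope.
Local Notation Re := complex.Re.
Local Notation Im := complex.Im.
(* In ring_scope, 'i denotes Num.imaginary, which is not convertible to this. *)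
Local Notation ci := (Complex 0 1).

(** * Derivatives of complex curves *)

(** The substitution zeta = z + e^w turns Cauchy's kernel d zeta / (zeta - z)^2 into e^(-w) dw, up
    to the factor of f, a circle around z into a vertical segment of length 2 pi, and the puncture
    at z into Re w = -oo. The transformed integrand is entire, so rectangles suffice and no domain
    with a hole or winding number enters. No complex-valued integral is formed: the integral along a
    horizontal or vertical line is the increment of a primitive of the restricted integrand, and
    integral estimates become mean value inequalities. *)

(** Clearing the denominator makes the estimate meaningful at [h = 0] too, so derivatives can be
    handled without quotients or punctured neighbourhoods. *)
Lemma is_derive_epsP (K : numFieldType) (W : normedModType K) (f : K -> W) (z : K) l :
  is_derive z 1 f l <->
  forall e, 0 < e -> \forall h \near (0 : K), `|f (z + h) - f z - h *: l| <= e * `|h|.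
Proof.
split=> [[fz <-] e e0|H].
  move/cvgrPdist_le: fz => /(_ e e0).
  rewrite near_withinE near_simpl => H.
  near=> h; have [->|h0] := eqVneq h 0.
    by rewrite addr0 subrr scale0r subrr !normr0 mulr0.
  have: h != 0 -> `|'D_1 f z - h^-1 *: ((f \o shift z) (h *: 1) - f z)| <= e.
    by near: h.
  move=> /(_ h0).
  rewrite /= [h *: 1]mulr1 [h + z]addrC => le.
  have -> : f (z + h) - f z - h *: 'D_1 f z =
    - (h *: ('D_1 f z - h^-1 *: (f (z + h) - f z))).
    by rewrite scalerBr scalerA divff// scale1r opprB.
  by rewrite normrN normrZ mulrC ler_wpM2r.
have cv : h^-1 *: ((f \o shift z) (h *: 1) - f z) @[h --> 0^'] --> l.
  apply/cvgrPdist_le => e e0; rewrite near_withinE.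
  near=> h => h0.
  have: `|f (z + h) - f z - h *: l| <= e * `|h| by near: h; exact: H.
  rewrite /= [h *: 1]mulr1 [h + z]addrC => le.
  have -> : l - h^-1 *: (f (z + h) - f z) = - (h^-1 *: (f (z + h) - f z - h *: l)).
    by rewrite [in RHS]scalerBr scalerA mulVf// scale1r opprB.
  by rewrite normrN normrZ normfV mulrC ler_pdivrMr ?normr_gt0.
apply: DeriveDef; first by apply/cvg_ex; exists l.
exact: (cvg_lim _ cv).
Unshelve. all: by end_near. Qed.

Lemma is_derive_comp1 (K : numFieldType) (W : normedModType K) (f : K -> W)
    (g : K -> K) (z : K) df dg :
  is_derive (g z) 1 f df -> is_derive z 1 g dg -> is_derive z 1 (fun t => f (g t)) (dg *: df).
Proof.
move=> [/derivable1_diffP Df <-] [/derivable1_diffP Dg <-].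
have Dfg : differentiable (f \o g) z by exact: differentiable_comp.
apply: DeriveDef; first exact/derivable1_diffP.
rewrite (deriveE _ Dfg) diff_comp //= -(deriveE _ Dg).
by rewrite -[X in 'd f _ X]mulr1 linearZ -(deriveE _ Df).
Qed.

Section RealCurves.
Variable R : realType.
Local Notation C := R[i].

Lemma norm_Re_le (z : C) (M : R) : `|z| <= M%:C -> `|Re z| <= M.
Proof. by move=> h; rewrite -lecR; apply: le_trans h; exact: normc_ge_Re. Qed.

Lemma norm_ci : `|ci| = 1 :> C.
Proof. by rewrite normc_def /= expr0n expr1n add0r sqrtr1. Qed.

Lemma norm_Im_le (z : C) (M : R) : `|z| <= M%:C -> `|Im z| <= M.
Proof.
move=> h; have -> : Im z = Re (- ci * z) by case: z {h} => a b /=; ring.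
by apply: norm_Re_le; rewrite normrM normrN norm_ci mul1r.
Qed.

Lemma normC_real (x : R) : `|x%:C| = `|x|%:C.
Proof. by rewrite normc_def /= expr0n addr0 sqrtr_sqr. Qed.

Lemma normC_le_ReIm (z : C) : `|z| <= (`|Re z| + `|Im z|)%:C.
Proof.
case: z => a b; have -> : a +i* b = a%:C + ci * b%:C.
  by apply/eqP; rewrite eq_complex /=; apply/andP; split; apply/eqP; ring.
rewrite rmorphD /=; apply: le_trans (ler_normD _ _) _.
rewrite normrM !normC_real.
by rewrite norm_ci mul1r; apply: lerD; rewrite lecR !(mul0r,mulr0,mul1r,subr0,addr0,add0r).
Qed.

Lemma pos_real (e : C) : 0 < e -> exists2 r : R, 0 < r & e = r%:C.
Proof.
case: e => a b; rewrite ltcE /= => /andP[/eqP -> a0]; by exists a.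
Qed.

End RealCurves.

(** * Global primitives of continuous real functions *)

Section Antiderivative.
Variable R : realType.
Notation mu := (@lebesgue_measure R).

Lemma is_derive_same_diff (G H g : R -> R) (a b : R) : a <= b ->
  (forall x, x \in `[a, b]%R -> is_derive x 1 G (g x)) ->
  (forall x, x \in `[a, b]%R -> is_derive x 1 H (g x)) ->
  G b - G a = H b - H a.
Proof.
move=> ab dG dH.
have dD x : x \in `[a, b]%R -> is_derive x 1 (G - H) 0.
  by move=> xab; rewrite -(subrr (g x)); apply: is_deriveB; [exact: dG|exact: dH].
have cD : {within `[a, b], continuous (G - H)}.
  apply: derivable_within_continuous => y yab.
  exact: (@ex_derive _ _ _ _ _ _ _ (dD y yab)).
have dD' x : x \in `]a, b[%R -> is_derive x 1 (G - H) ((fun=> 0) x).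
  by move=> xab; apply: dD; apply: subset_itv_oo_cc xab.
have [c _] := MVT_segment ab dD' cD.
by rewrite mul0r !fctE => h; lra.
Qed.

Lemma antiderivative_above (g : R -> R) (a : R) : continuous g ->
  exists G : R -> R, forall x : R, a < x -> is_derive x 1 G (g x).
Proof.
move=> cg; exists (fun x => \int[mu]_(t in `[a, x]) g t)%R => x ax.
have [] := @continuous_FTC1_closed R g a x (x + 1) _ _ ax (cg x).
- by rewrite ltrDl.
- apply: continuous_compact_integrable; first exact: segment_compact.
  exact: continuous_subspaceT.
- by move=> d dg; apply: DeriveDef; [exact: d|rewrite -derive1E; exact: dg].
Qed.

(** Integration from a fixed endpoint gives a primitive only to the right of it. The primitives
    [F n] on ]-(n+1), +oo[ are glued: once normalized to vanish at 0, they agree wherever two of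
    them are defined. *)
Lemma antiderivative_real (g : R -> R) : continuous g ->
  exists G : R -> R, forall x : R, is_derive x 1 G (g x).
Proof.
move=> cg.
have /choice [F FP] (n : nat) := antiderivative_above (- n.+1%:R) cg.
pose N (x : R) := Num.truncn `|x|.
have NP x : `|x| < (N x).+1%:R by exact: truncnS_gt.
have eqF n m x : `|x| < n.+1%:R -> `|x| < m.+1%:R -> F n x - F n 0 = F m x - F m 0.
  rewrite !ltr_norml => /andP[n1 _] /andP[m1 _].
  have [x0|x0] := leP 0 x.
    apply: (is_derive_same_diff (g := g)) => // y;
      rewrite in_itv /= => /andP[y0 _]; apply: FP; apply: lt_le_trans y0;
      by rewrite oppr_lt0 ltr0Sn.
  apply: oppr_inj; rewrite !opprB.
  apply: (is_derive_same_diff (g := g)); first exact: ltW.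
    by move=> y; rewrite in_itv /= => /andP[y0 _]; apply: FP; apply: lt_le_trans y0.
  by move=> y; rewrite in_itv /= => /andP[y0 _]; apply: FP; apply: lt_le_trans y0.
(* The index [N y] varies with the point, but near [x] the fixed index [N x] is also admissible, and
   by [eqF] it gives the same value. *)
exists (fun x => F (N x) x - F (N x) 0) => x.
have dF : is_derive x 1 (fun y => F (N x) y - F (N x) 0) (g x).
  rewrite -[g x]subr0; apply: is_deriveB.
  by apply: FP; have := NP x; rewrite ltr_norml => /andP[].
apply: near_eq_is_derive dF.
have : \forall y \near x, `|y| < (N x).+1%:R.
  by apply: (@cvgr_norm_lt _ R^o _ (nbhs x) _ id x); [exact: cvg_id|exact: NP].
by apply: filterS => y yN; apply: eqF.
Qed.

End Antiderivative.

(** * Complex-valued functions of a real parameter *)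

Section Curves.
Variable R : realType.
Local Notation C := R[i].

(* R[i] carries no structure of normed module over R, so is_derive does not apply
   to G directly. *)
Definition is_cderive (G : R -> C) (t : R) (l : C) :=
  is_derive t 1 (fun u => Re (G u)) (Re l) /\
  is_derive t 1 (fun u => Im (G u)) (Im l).

Lemma is_cderive_eps (G : R -> C) (t : R) (l : C) :
  (forall e : R, 0 < e ->
     \forall h \near (0 : R), `|G (t + h) - G t - h%:C * l| <= (e * `|h|)%:C) ->
  is_cderive G t l.
Proof.
move=> H; split; apply/is_derive_epsP => e /H; apply: filterS => h.
- move=> /norm_Re_le; congr (`|_| <= _).
  by case: (G (t + h)) (G t) l {H} => a b [c d] [p q] /=; rewrite /GRing.scale /=; ring.
- move=> /norm_Im_le; congr (`|_| <= _).
  by case: (G (t + h)) (G t) l {H} => a b [c d] [p q] /=; rewrite /GRing.scale /=; ring.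
Qed.

Lemma is_cderive_line (F : C -> C) (p d : C) (t : R) (l : C) :
  is_derive (p + t%:C * d) 1 F l ->
  is_cderive (fun u => F (p + u%:C * d)) t (d * l).
Proof.
move=> /is_derive_epsP H; apply: is_cderive_eps => e e0.
(* The direction [d] may be 0, hence the division by [|d| + 1]. *)
have d0 : 0 < `|d| + 1 by rewrite ltr_wpDl.
have ed0 : 0 < e%:C / (`|d| + 1) by rewrite divr_gt0// ltcR.
have lin : (fun h : R => h%:C * d) h @[h --> (0 : R)] --> (0 : C).
  apply/cvgrPdist_le => e' e'0.
  have [r r0 er] := pos_real (divr_gt0 e'0 d0).
  near=> h; rewrite sub0r normrN normrM normC_real.
  apply: (@le_trans _ _ (r%:C * (`|d| + 1))).
    apply: ler_pM; rewrite ?normr_ge0 ?ler0c ?lerDl//; rewrite lecR.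
    near: h; exact: (@nbhs0_le _ R^o _ r0).
  by rewrite -er divfK// gt_eqF.
have : \forall h \near (0 : R), `|F (p + t%:C * d + h%:C * d) -
    F (p + t%:C * d) - (h%:C * d) *: l| <= e%:C / (`|d| + 1) * `|h%:C * d|.
  exact: lin _ (H _ ed0).
apply: filterS => h.
have -> : p + t%:C * d + h%:C * d = p + (t + h)%:C * d.
  by rewrite rmorphD /=; ring.
rewrite /GRing.scale /= => le.
rewrite mulrA; apply: le_trans le _.
rewrite normrM normC_real rmorphM /=.
rewrite [leLHS](_ : _ = e%:C * `|h|%:C * (`|d| / (`|d| + 1))); last by ring.
apply: ler_piMr; first by rewrite mulr_ge0 // ler0c // ltW.
by rewrite ler_pdivrMr // mul1r lerDl.
Unshelve. all: by end_near. Qed.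

Lemma is_cderiveB (G H : R -> C) t g h :
  is_cderive G t g -> is_cderive H t h -> is_cderive (fun u => G u - H u) t (g - h).
Proof.
have ReB (z w : C) : Re (z - w) = Re z - Re w by case: z; case: w.
have ImB (z w : C) : Im (z - w) = Im z - Im w by case: z; case: w.
move=> [G1 G2] [H1 H2]; split.
  by under eq_fun do rewrite ReB; rewrite ReB; exact: is_deriveB.
by under eq_fun do rewrite ImB; rewrite ImB; exact: is_deriveB.
Qed.

Lemma is_cderiveMl (c : C) (G : R -> C) t g :
  is_cderive G t g -> is_cderive (fun u => c * G u) t (c * g).
Proof.
have ReM (z w : C) : Re (z * w) = Re z * Re w - Im z * Im w by case: z; case: w.
have ImM (z w : C) : Im (z * w) = Re z * Im w + Im z * Re w.
  by case: z; case: w => * /=; ring.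
move=> [G1 G2]; split.
  under eq_fun do rewrite ReM; rewrite ReM.
  by apply: is_deriveB; apply: is_deriveZ.
under eq_fun do rewrite ImM; rewrite ImM.
by apply: is_deriveD; apply: is_deriveZ.
Qed.

Lemma is_derive_MVT_le (G g : R -> R) (a b M : R) : a <= b ->
  (forall t : R, is_derive t 1 G (g t)) ->
  (forall t, t \in `[a, b]%R -> `|g t| <= M) -> `|G b - G a| <= M * (b - a).
Proof.
move=> ab dG gM.
have cG : {within `[a, b], continuous G}.
  apply: derivable_within_continuous => y yab.
  exact: (@ex_derive _ _ _ _ _ _ _ (dG y)).
have [c cab ->] := MVT_segment ab (fun x _ => dG x) cG.
by rewrite normrM [`|b - a|]ger0_norm ?subr_ge0// ler_wpM2r ?subr_ge0// gM.
Qed.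

(* The factor 2 comes from treating the real and imaginary parts separately. *)
Lemma is_cderive_MVT_le (G g : R -> C) (a b M : R) : a <= b ->
  (forall t, is_cderive G t (g t)) ->
  (forall t, t \in `[a, b]%R -> `|g t| <= M%:C) ->
  `|G b - G a| <= (2 * M * (b - a))%:C.
Proof.
move=> ab dG gM; apply: le_trans (normC_le_ReIm _) _; rewrite lecR.
have -> : Re (G b - G a) = Re (G b) - Re (G a) by case: (G b); case: (G a).
have -> : Im (G b - G a) = Im (G b) - Im (G a) by case: (G b); case: (G a).
have -> : 2 * M * (b - a) = M * (b - a) + M * (b - a) by ring.
apply: lerD.
  apply: (is_derive_MVT_le (G := fun u => Re (G u)) ab (fun t => (dG t).1)).
  by move=> t /gM /norm_Re_le.
apply: (is_derive_MVT_le (G := fun u => Im (G u)) ab (fun t => (dG t).2)).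
by move=> t /gM /norm_Im_le.
Qed.

(** The increment of a primitive depends only on the integrand, so it can serve as the integral of
    [g] from [a] to [b], in either order of the endpoints. This is the mean value inequality with
    bound 0 for [G - H]. *)
Lemma is_cderive_unique (G H g : R -> C) (a b : R) :
  (forall t, is_cderive G t (g t)) -> (forall t, is_cderive H t (g t)) ->
  G b - G a = H b - H a.
Proof.
move=> dG dH; wlog ab : a b / a <= b.
  move=> W; have [/W //|/ltW/W E] := leP a b.
  by apply: oppr_inj; rewrite !opprB.
have := is_cderive_MVT_le (M := 0) ab (fun t => is_cderiveB (dG t) (dH t)).
rewrite mulr0 mul0r normr_le0 => /(_ _) E.
apply/eqP; rewrite -subr_eq0.
have -> : G b - G a - (H b - H a) = G b - H b - (G a - H a) by ring.
by apply: E => t _; rewrite subrr normr0.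
Qed.

Lemma near_norm_le (z : C) (e : R) : 0 < e -> \forall w \near z, `|z - w| <= e%:C.
Proof.
move=> e0; have e0' : 0 < e%:C :> C by rewrite ltcR.
exact: (@cvgr_dist_le _ R[i] _ (nbhs z) (nbhs_filter z) id z (@cvg_id _ _) _ e0').
Qed.

Lemma continuous_Re : continuous (@complex.Re R).
Proof.
move=> z; apply/(@cvgrPdist_le _ R^o _ _ (nbhs_filter z)) => e /(near_norm_le z).
apply: filterS => w.
have -> : Re z - Re w = Re (z - w) by case: (z); case: (w).
exact: norm_Re_le.
Qed.

Lemma continuous_Im : continuous (@complex.Im R).
Proof.
move=> z; apply/(@cvgrPdist_le _ R^o _ _ (nbhs_filter z)) => e /(near_norm_le z).
apply: filterS => w.
have -> : Im z - Im w = Im (z - w) by case: (z); case: (w).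
exact: norm_Im_le.
Qed.

Lemma antiderivative_complex (g : R -> C) : continuous g ->
  exists G, forall t, is_cderive G t (g t).
Proof.
move=> cg.
have [|G1 d1] := @antiderivative_real R (@complex.Re R \o g).
  by move=> t; apply: continuous_comp; [exact: cg|exact: continuous_Re].
have [|G2 d2] := @antiderivative_real R (@complex.Im R \o g).
  by move=> t; apply: continuous_comp; [exact: cg|exact: continuous_Im].
by exists (fun t => G1 t +i* G2 t) => t; split; [exact: d1|exact: d2].
Qed.

End Curves.

(** * The complex exponential *)

Section ComplexExp.
Variable R : realType.
Local Notation C := R[i].

Definition cexp (z : C) : C := (expR (Re z))%:C * (cos (Im z) +i* sin (Im z)).

Arguments cexp : simpl never.

Lemma cexpD (z w : C) : cexp (z + w) = cexp z * cexp w.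
Proof.
case: z w => a b [c d]; rewrite /cexp /= expRD cosD sinD.
by apply/eqP; rewrite eq_complex /=; apply/andP; split; apply/eqP; ring.
Qed.

Lemma cexp0 : cexp 0 = 1.
Proof. by rewrite /cexp /= expR0 cos0 sin0 mul1r. Qed.

Lemma cexpN (z : C) : cexp z * cexp (- z) = 1.
Proof. by rewrite -cexpD subrr cexp0. Qed.

Lemma cexp_neq0 (z : C) : cexp z != 0.
Proof.
by apply/eqP => z0; have /eqP := cexpN z; rewrite z0 mul0r eq_sym oner_eq0.
Qed.

Lemma norm_cexp (z : C) : `|cexp z| = (expR (Re z))%:C.
Proof.
rewrite normrM normC_real [`|expR _|]ger0_norm ?expR_ge0// normc_def /= cos2Dsin2 sqrtr1.
by rewrite mulr1.
Qed.

Lemma cexp_2pi_periodic (z : C) : cexp (z + 0 +i* (2 * pi)) = cexp z.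
Proof.
rewrite cexpD /cexp /= expR0 mulr2n.
have -> : (1 + 1) * pi = pi *+ 2 :> R by rewrite mulr2n; ring.
by rewrite cos2pi sin2pi !mulr1.
Qed.

(** Complex differentiability is derived from the real derivatives of [expR], [cos] and [sin] at 0;
    the addition law [cexpD] then carries it to every point. *)
Lemma is_derive_cexp0 : is_derive (0 : C) 1 cexp 1.
Proof.
apply/is_derive_epsP => e /pos_real [r r0 ->].
have [dE dC dS] : [/\ is_derive (0:R) 1 (@expR R) 1, is_derive (0:R) 1 (@cos R) 0 &
   is_derive (0:R) 1 (@sin R) 1].
  split.
  - by apply: (is_derive_eq (is_derive_expR 0)); rewrite expR0.
  - by apply: (is_derive_eq (is_derive_cos 0)); rewrite sin0 oppr0.
  - by apply: (is_derive_eq (is_derive_sin 0)); rewrite cos0.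
(* The errors add up to n (|x| + 5 |y|), at most 6 n |h| for h = x + iy. The bound n <= 1 gives |e^x
   - 1| <= n and |e^x| <= 2 once |x| <= n / 2. *)
pose n := Num.min (r / 6) 1.
have n0 : 0 < n by rewrite lt_min ltr01 andbT divr_gt0.
have n1 : n <= 1 by rewrite ge_min lexx orbT.
have nr : 6 * n <= r.
  have : n <= r / 6 by rewrite ge_min lexx.
  lra.
have /is_derive_epsP /(_ _ n0) HE := dE.
have /is_derive_epsP /(_ _ n0) HC := dC.
have /is_derive_epsP /(_ _ n0) HS := dS.
have H1 : \forall h \near (0 : R), `|h| <= n / 2.
  by apply: (@nbhs0_le _ R^o); rewrite divr_gt0.
have HI : \forall h \near (0 : C),
    `|cos (0 + Im h) - cos 0 - Im h *: 0| <= n * `|Im h| /\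
    `|sin (0 + Im h) - sin 0 - Im h *: 1| <= n * `|Im h|.
  exact: (@continuous_Im R 0 _ (filterI HC HS)).
have HR : \forall h \near (0 : C),
    `|expR (0 + Re h) - expR 0 - Re h *: 1| <= n * `|Re h| /\ `|Re h| <= n / 2.
  exact: (@continuous_Re R 0 _ (filterI HE H1)).
apply: filterS2 HR HI => -[x y] /=.
rewrite !add0r expR0 cos0 sin0 /GRing.scale /= !mulr1 !mulr0 !subr0 => -[h1 h2] [h3 h4].
rewrite /cexp /= cos0 sin0 expR0.
apply: le_trans (normC_le_ReIm _) _ => /=.
have hx : `|x|%:C <= `|x +i* y| by exact: (normc_ge_Re (x +i* y)).
have hy : `|y|%:C <= `|x +i* y|.
  rewrite -normC_real; apply: (@le_trans _ _ (`|0 +i* y|)).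
    by rewrite !normc_def /= lecR expr0n addr0 add0r.
  rewrite !normc_def /= lecR ler_wsqrtr// lerD2r.
  by rewrite expr0n sqr_ge0.
apply: (@le_trans _ _ (n * (`|x| + 5 * `|y|))%:C).
  rewrite lecR.
  have E1 : `|expR x - 1| <= n.
    have -> : expR x - 1 = (expR x - 1 - x) + x by ring.
    apply: le_trans (ler_normD _ _) _; have := normr_ge0 x; nra.
  have E2 : `|expR x| <= 2.
    have -> : expR x = (expR x - 1) + 1 by ring.
    by apply: le_trans (ler_normD _ _) _; rewrite normr1; lra.
  have -> : expR x * cos y - 0 * sin y - (1 * 1 - 0 * 0) - x = (expR x - 1 - x) + expR x * (cos y - 1).
    by ring.
  have -> : expR x * sin y + 0 * cos y - (1 * 0 + 0 * 1) - y = expR x * (sin y - y) + (expR x - 1) * y.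
    by ring.
  have M1 : `|expR x * (cos y - 1)| <= 2 * (n * `|y|).
    by rewrite normrM ler_pM.
  have M2 : `|expR x * (sin y - y)| <= 2 * (n * `|y|).
    by rewrite normrM ler_pM.
  have M3 : `|(expR x - 1) * y| <= n * `|y|.
    by rewrite normrM ler_pM.
  have := ler_normD (expR x - 1 - x) (expR x * (cos y - 1)).
  have := ler_normD (expR x * (sin y - y)) ((expR x - 1) * y).
  lra.
rewrite rmorphM rmorphD rmorphM /=.
apply: (@le_trans _ _ (n%:C * (`|x +i* y| + 5%:C * `|x +i* y|))).
  apply: ler_wpM2l; first by rewrite ler0c ltW.
  by apply: lerD => //; apply: ler_wpM2l; rewrite // ler0c.
have -> : n%:C * (`|x +i* y| + 5%:C * `|x +i* y|) = (6 * n)%:C * `|x +i* y|.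
  by rewrite !rmorphM /= !rmorph_nat; ring.
by rewrite ler_wpM2r // lecR.
Qed.

Lemma is_derive_cexp (z : C) : is_derive z 1 cexp (cexp z).
Proof.
apply/is_derive_epsP => e e0.
have e1 : 0 < e / `|cexp z| by rewrite divr_gt0 // normr_gt0 cexp_neq0.
have /is_derive_epsP /(_ _ e1) := is_derive_cexp0.
apply: filterS => h; rewrite add0r cexp0 cexpD /GRing.scale /= mulr1 => le.
have -> : cexp z * cexp h - cexp z - h * cexp z = cexp z * (cexp h - 1 - h) by ring.
rewrite normrM mulrC -ler_pdivlMr ?normr_gt0 ?cexp_neq0 //.
by rewrite mulrAC.
Qed.

End ComplexExp.

(** * Goursat's theorem on rectangles *)

Section Bisection.
Variable R : realType.

(** The hypothesis says that the intervals [x n, x n + W / 2^n] are nested; the supremum of their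
    left endpoints lies in all of them. *)
Lemma nested_point (x : nat -> R) (W : R) : 0 <= W ->
  (forall n, x n <= x n.+1 <= x n + W / 2 ^+ n.+1) ->
  exists p, forall n, x n <= p <= x n + W / 2 ^+ n.
Proof.
move=> W0 xS.
have halfE n : W / 2 ^+ n.+1 + W / 2 ^+ n.+1 = W / 2 ^+ n.
  by rewrite exprS; field; rewrite gt_eqF.
have xle n m : x n <= x (n + m)%N.
  elim: m => [|m IH]; first by rewrite addn0.
  by rewrite addnS; apply: le_trans IH _; case/andP: (xS (n + m)%N).
have xup n m : x (n + m)%N + W / 2 ^+ (n + m) <= x n + W / 2 ^+ n.
  elim: m => [|m IH]; first by rewrite addn0.
  rewrite addnS; apply: le_trans IH; have /andP[_ h] := xS (n + m)%N.
  by rewrite -(halfE (n + m)%N) addrA lerD2r.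
have xub n m : x m <= x n + W / 2 ^+ n.
  apply: (le_trans (xle m n)); rewrite addnC; apply: le_trans (xup n m).
  by rewrite lerDl divr_ge0 // ltW.
exists (sup (range x)) => n; apply/andP; split.
  apply: ub_le_sup; last by exists n.
  by exists (x 0%N + W / 2 ^+ 0) => _ [m _ <-].
by apply: ge_sup; [exists (x 0%N), 0%N|move=> _ [m _ <-]].
Qed.

(** Here [P a b n] concerns the rectangle of size W / 2^n by H / 2^n with lower left corner (a, b).
    If it failed for one rectangle, it would fail for one of the quarters, and so on; the failing
    rectangles shrink to a point (p, q), against the local hypothesis there. *)
Lemma bisection (P : R -> R -> nat -> Prop) (W H : R) : 0 <= W -> 0 <= H ->
  (forall a b n,
     P a b n.+1 -> P (a + W / 2 ^+ n.+1) b n.+1 -> P a (b + H / 2 ^+ n.+1) n.+1 ->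
     P (a + W / 2 ^+ n.+1) (b + H / 2 ^+ n.+1) n.+1 -> P a b n) ->
  (forall p q, exists n, forall a b,
     a <= p <= a + W / 2 ^+ n -> b <= q <= b + H / 2 ^+ n -> P a b n) ->
  forall a b, P a b 0%N.
Proof.
move=> W0 H0 step loc a b; apply: contrapT => nP.
have W0n n : 0 <= W / 2 ^+ n by rewrite divr_ge0 // exprn_ge0.
have H0n n : 0 <= H / 2 ^+ n by rewrite divr_ge0 // exprn_ge0.
have next (s : nat * (R * R)) : exists v : R * R, ~ P s.2.1 s.2.2 s.1 ->
    [/\ ~ P v.1 v.2 s.1.+1, s.2.1 <= v.1 <= s.2.1 + W / 2 ^+ s.1.+1
      & s.2.2 <= v.2 <= s.2.2 + H / 2 ^+ s.1.+1].
  case: s => n [c d] /=.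
  (* Where [P] holds the implication is vacuous and any [v] serves; this makes the selection total,
     as [choice] requires. *)
  have [Q|nQ] := pselect (P c d n); first by exists (c, d).
  have bnd (x h : R) : 0 <= h -> (x <= x <= x + h) && (x <= x + h <= x + h).
    by move=> h0; rewrite !lexx lerDl h0.
  have /andP[c1 c2] := bnd c _ (W0n n.+1).
  have /andP[d1 d2] := bnd d _ (H0n n.+1).
  apply: contrapT => none; apply: nQ.
  apply: step; apply: contrapT => nq; apply: none.
  - by exists (c, d).
  - by exists (c + W / 2 ^+ n.+1, d).
  - by exists (c, d + H / 2 ^+ n.+1).
  - by exists (c + W / 2 ^+ n.+1, d + H / 2 ^+ n.+1).
have [f fP] := choice next.
pose u := fix u n := if n is m.+1 then f (m, u m) else (a, b).
have uP n : ~ P (u n).1 (u n).2 n.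
  by elim: n => [//|n IH]; have [] := fP (n, u n) IH.
have [p pP] : exists p, forall n, (u n).1 <= p <= (u n).1 + W / 2 ^+ n.
  by apply: nested_point => // n; have [] := fP (n, u n) (uP n).
have [q qP] : exists q, forall n, (u n).2 <= q <= (u n).2 + H / 2 ^+ n.
  by apply: nested_point => // n; have [] := fP (n, u n) (uP n).
by have [n /(_ _ _ (pP n) (qP n)) /uP] := loc p q.
Qed.

End Bisection.

Section Goursat.
Variable R : realType.
Local Notation C := R[i].

Lemma is_cderive_horizontal (F : C -> C) (b t : R) (l : C) :
  is_derive (t +i* b) 1 F l -> is_cderive (fun u => F (u +i* b)) t l.
Proof.
have E u : u +i* b = 0 +i* b + u%:C * 1.
  by apply/eqP; rewrite eq_complex /=; apply/andP; split; apply/eqP; ring.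
rewrite E => /is_cderive_line; rewrite mul1r.
by under [X in _ -> is_cderive X _ _]eq_fun do rewrite E.
Qed.

Lemma is_cderive_vertical (F : C -> C) (a t : R) (l : C) :
  is_derive (a +i* t) 1 F l -> is_cderive (fun u => F (a +i* u)) t (ci * l).
Proof.
have E u : a +i* u = a%:C + u%:C * ci.
  by apply/eqP; rewrite eq_complex /=; apply/andP; split; apply/eqP; ring.
rewrite E => /is_cderive_line.
by under [X in _ -> is_cderive X _ _]eq_fun do rewrite E.
Qed.

(* When PH b is a primitive of t |-> g (t + ib) and PV a one of t |-> g (a + it),
   this is the integral of g dz along the boundary of [a, a'] x [b, b']. *)
Definition rect_int (PH PV : R -> R -> C) (a a' b b' : R) : C :=
  PH b a' - PH b a + ci * (PV a' b' - PV a' b)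
  - (PH b' a' - PH b' a) - ci * (PV a b' - PV a b).

(* The affine part al + be * (w - p) has the primitive Q, hence contributes
   nothing; only the remainder, of size e * |w - p|, is left to integrate. *)
Lemma rect_int_local (g : C -> C) (PH PV : R -> R -> C) (p al be : C)
    (e L a a' b b' : R) :
  (forall s t, is_cderive (PH s) t (g (t +i* s))) ->
  (forall s t, is_cderive (PV s) t (g (s +i* t))) ->
  a <= Re p <= a' -> b <= Im p <= b' -> a' - a <= L -> b' - b <= L -> 0 <= e ->
  (forall w, a <= Re w <= a' -> b <= Im w <= b' ->
     `|g w - al - be * (w - p)| <= e%:C * `|w - p|) ->
  `|rect_int PH PV a a' b b'| <= (16 * e * L ^+ 2)%:C.
Proof.
move=> dPH dPV ap bp aL bL e0 gP.
pose Q (w : C) : C := al * w + be * ((w - p) ^+ 2 / 2).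
have dQ (w : C) : is_derive w 1 Q (al + be * (w - p)).
  apply: is_derive_eq; rewrite /GRing.scale /=; field; rewrite ?pnatr_eq0 //.
have aa' : a <= a' by case/andP: ap; exact: le_trans.
have bb' : b <= b' by case/andP: bp; exact: le_trans.
have L0 : 0 <= L by apply: le_trans aL; rewrite subr_ge0.
(* On the rectangle |w - p| <= |Re (w - p)| + |Im (w - p)| <= 2 L. With the factor 2 of the mean
   value inequality each side contributes at most 2 (2 e L) L = 4 e L^2, whence the constant 16. *)
have bnd w : a <= Re w <= a' -> b <= Im w <= b' ->
    `|g w - (al + be * (w - p))| <= (e * (2 * L))%:C.
  move=> wa wb; rewrite opprD addrA; apply: (le_trans (gP _ wa wb)).
  rewrite rmorphM /=; apply: ler_wpM2l; first by rewrite ler0c.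
  apply: le_trans (normC_le_ReIm _) _; rewrite lecR.
  case: w p ap bp wa wb {gP Q dQ} => x y [p1 p2] /= ap bp wa wb.
  have : `|x - p1| <= L by rewrite ler_norml; apply/andP; split; lra.
  have : `|y - p2| <= L by rewrite ler_norml; apply/andP; split; lra.
  lra.
have eL0 : 0 <= 2 * (e * (2 * L)) by rewrite !mulr_ge0.
have horiz s : b <= s <= b' ->
    `|(PH s a' - Q (a' +i* s)) - (PH s a - Q (a +i* s))| <= (4 * e * L ^+ 2)%:C.
  move=> sb.
  have H := is_cderive_MVT_le (M := e * (2 * L)) aa' (fun t => is_cderiveB (dPH s t)
      (is_cderive_horizontal (dQ (t +i* s)))).
  apply: le_trans (H _) _.
    by move=> t; rewrite in_itv /= => ta; exact: bnd.
  rewrite lecR; apply: (@le_trans _ _ (2 * (e * (2 * L)) * L)); last by lra.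
  exact: ler_wpM2l.
have vert s : a <= s <= a' ->
    `|(ci * PV s b' - Q (s +i* b')) - (ci * PV s b - Q (s +i* b))| <= (4 * e * L ^+ 2)%:C.
  move=> sa.
  have H := is_cderive_MVT_le (M := e * (2 * L)) bb' (fun t => is_cderiveB
      (is_cderiveMl ci (dPV s t)) (is_cderive_vertical (dQ (s +i* t)))).
  apply: le_trans (H _) _.
    move=> t; rewrite in_itv /= => tb; rewrite -mulrBr normrM.
    by rewrite norm_ci mul1r; exact: bnd.
  rewrite lecR; apply: (@le_trans _ _ (2 * (e * (2 * L)) * L)); last by lra.
  exact: ler_wpM2l.
have -> : rect_int PH PV a a' b b' =
    ((PH b a' - Q (a' +i* b)) - (PH b a - Q (a +i* b)))
  + ((ci * PV a' b' - Q (a' +i* b')) - (ci * PV a' b - Q (a' +i* b)))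
  - ((PH b' a' - Q (a' +i* b')) - (PH b' a - Q (a +i* b')))
  - ((ci * PV a b' - Q (a +i* b')) - (ci * PV a b - Q (a +i* b))).
  by rewrite /rect_int; ring.
have -> : (16 * e * L ^+ 2)%:C = (4 * e * L ^+ 2)%:C + (4 * e * L ^+ 2)%:C
    + (4 * e * L ^+ 2)%:C + (4 * e * L ^+ 2)%:C.
  by rewrite -!rmorphD /=; congr (_%:C); ring.
have ina : a <= a <= a' by rewrite lexx.
have ina' : a <= a' <= a' by rewrite lexx andbT.
have inb : b <= b <= b' by rewrite lexx.
have inb' : b <= b' <= b' by rewrite lexx andbT.
apply: le_trans (ler_normB _ _) _; apply: lerD; last exact: vert.
apply: le_trans (ler_normB _ _) _; apply: lerD; last exact: horiz.
apply: le_trans (ler_normD _ _) _; apply: lerD; [exact: horiz|exact: vert].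
Qed.

(** For arbitrary [E > 0], a rectangle of generation n is shown to have integral at most E / 4^n.
    The bound passes from quarters to the whole because the inner sides cancel, and it holds for
    small rectangles because the first-order remainder and the perimeter are both controlled by the
    side length. *)
Theorem goursat_rect (g : C -> C) (PH PV : R -> R -> C) (a b W H : R) :
  (forall z, derivable g z 1) ->
  (forall s t, is_cderive (PH s) t (g (t +i* s))) ->
  (forall s t, is_cderive (PV s) t (g (s +i* t))) ->
  0 <= W -> 0 <= H -> rect_int PH PV a (a + W) b (b + H) = 0.
Proof.
move=> dg dPH dPV W0 H0.
suff small (E : R) : 0 < E -> `|rect_int PH PV a (a + W) b (b + H)| <= E%:C.
  apply/eqP; rewrite -normr_le0; apply/ler_addgt0Pr => _ /pos_real[E E0 ->].
  by rewrite add0r small.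
move=> E0.
have := @bisection R (fun a b n => `|rect_int PH PV a (a + W / 2 ^+ n) b (b + H / 2 ^+ n)|
  <= (E / 4 ^+ n)%:C) W H W0 H0 _ _ a b.
rewrite !expr0 !divr1; apply.
  move=> {}a {}b n.
  have hW : W / 2 ^+ n = W / 2 ^+ n.+1 + W / 2 ^+ n.+1.
    by rewrite exprS; field; rewrite gt_eqF // exprn_gt0.
  have hH : H / 2 ^+ n = H / 2 ^+ n.+1 + H / 2 ^+ n.+1.
    by rewrite exprS; field; rewrite gt_eqF // exprn_gt0.
  have hE : E / 4 ^+ n = E / 4 ^+ n.+1 + E / 4 ^+ n.+1 + E / 4 ^+ n.+1 + E / 4 ^+ n.+1.
    by rewrite exprS; field; rewrite gt_eqF // exprn_gt0.
  rewrite hW hH !addrA hE !rmorphD /=.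
  move: (W / 2 ^+ n.+1) (H / 2 ^+ n.+1) => w h h1 h2 h3 h4.
  have -> : rect_int PH PV a (a + w + w) b (b + h + h) =
      rect_int PH PV a (a + w) b (b + h) + rect_int PH PV (a + w) (a + w + w) b (b + h)
    + rect_int PH PV a (a + w) (b + h) (b + h + h)
    + rect_int PH PV (a + w) (a + w + w) (b + h) (b + h + h).
    by rewrite /rect_int; ring.
  by do 3 (apply: le_trans (ler_normD _ _) _; apply: lerD => //).
(* [L] bounds both sides and also |w - p|. The choice of [e] makes 16 e (L / 2^n)^2 at most E / 4^n;
   the summand 1 keeps the denominator positive when L = 0. *)
move=> p q; pose L := W + H; pose e := E / (16 * (L ^+ 2 + 1)).
have L0 : 0 <= L by rewrite addr_ge0.
have D0 : 0 < 16 * (L ^+ 2 + 1) by rewrite mulr_gt0 // ltr_wpDl // sqr_ge0.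
have e0 : 0 < e by rewrite divr_gt0.
have e0' : 0 < e%:C :> C by rewrite ltcR.
have dgpq : is_derive (p +i* q) 1 g ('D_1 g (p +i* q)) by exact: derivableP.
have /is_derive_epsP /(_ _ e0') /nbhs_ballP[_ /= /pos_real[r r0 ->] rP] := dgpq.
have [n nP] : exists n, L / 2 ^+ n < r.
  exists (Num.truncn (L / r)).+1.
  rewrite ltr_pdivrMr ?exprn_gt0 // mulrC -ltr_pdivrMr //.
  apply: lt_trans (truncnS_gt _) _; rewrite -natrX ltr_nat.
  exact: ltn_expl.
exists n => {}a {}b ap bq.
have Wn : 0 <= W / 2 ^+ n by rewrite divr_ge0 // exprn_ge0.
have Hn : 0 <= H / 2 ^+ n by rewrite divr_ge0 // exprn_ge0.
have LE : L / 2 ^+ n = W / 2 ^+ n + H / 2 ^+ n by rewrite mulrDl.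
apply: le_trans (rect_int_local (p := p +i* q) (al := g (p +i* q))
  (be := 'D_1 g (p +i* q)) (e := e) (L := L / 2 ^+ n) dPH dPV ap bq _ _ (ltW e0) _) _.
- by rewrite addrAC subrr add0r LE lerDl.
- by rewrite addrAC subrr add0r LE lerDr.
- move=> w wa wb.
  have inb : ball (0 : C) r%:C (w - p +i* q).
    rewrite /ball /= sub0r normrN; apply: le_lt_trans (normC_le_ReIm _) _.
    rewrite ltcR; apply: le_lt_trans nP; rewrite LE.
    case: w wa wb => x y /= wa wb.
    by apply: lerD; rewrite ler_norml; apply/andP; split; lra.
  have := rP _ inb.
  have -> : p +i* q + (w - p +i* q) = w by ring.
  by rewrite [_ *: _]mulrC.
rewrite lecR.
have -> : 16 * e * (L / 2 ^+ n) ^+ 2 = E / 4 ^+ n * (L ^+ 2 / (L ^+ 2 + 1)).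
  have -> : 4 ^+ n = (2 ^+ n) ^+ 2 :> R by rewrite -exprM mulnC exprM; congr (_ ^+ n); ring.
  rewrite /e; field.
  by rewrite expf_neq0 ?pnatr_eq0 // andbT gt_eqF // ltr_wpDl // sqr_ge0.
apply: ler_piMr; first by rewrite divr_ge0 ?exprn_ge0 // ltW.
by rewrite ler_pdivrMr ?mul1r ?lerDl // ltr_wpDl // sqr_ge0.
Qed.

End Goursat.

(** * The derivative of an entire function *)

Section CauchyDerivative.
Variable R : realType.
Local Notation C := R[i].

Lemma continuous_vertical (a : R) : continuous (fun t : R => a +i* t).
Proof.
move=> t; apply/(@cvgrPdist_le _ C _ _ (nbhs_filter t)) => _ /pos_real[e e0 ->].
have H : \forall u \near t, `|t - u| <= e.
  exact: (@cvgr_dist_le _ R^o _ (nbhs t) (nbhs_filter t) id t (@cvg_id _ _) _ e0).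
apply: filterS H => u tu.
have -> : a +i* t - a +i* u = ci * (t - u)%:C.
  by apply/eqP; rewrite eq_complex /=; apply/andP; split; apply/eqP; ring.
by rewrite normrM norm_ci mul1r normC_real lecR.
Qed.

Lemma continuous_horizontal (b : R) : continuous (fun t : R => t +i* b).
Proof.
move=> t; apply/(@cvgrPdist_le _ C _ _ (nbhs_filter t)) => _ /pos_real[e e0 ->].
have H : \forall u \near t, `|t - u| <= e.
  exact: (@cvgr_dist_le _ R^o _ (nbhs t) (nbhs_filter t) id t (@cvg_id _ _) _ e0).
apply: filterS H => u tu.
have -> : t +i* b - u +i* b = (t - u)%:C.
  by apply/eqP; rewrite eq_complex /=; apply/andP; split; apply/eqP; ring.
by rewrite normC_real lecR.
Qed.

Lemma derivable_continuous (f : C -> C) : (forall z : C, derivable f z 1) -> continuous f.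
Proof. by move=> df z; apply: differentiable_continuous; apply/derivable1_diffP. Qed.

Lemma vertical_antiderivative (g : C -> C) : continuous g ->
  exists P : R -> R -> C, forall s t, is_cderive (P s) t (g (s +i* t)).
Proof.
move=> cg.
suff /choice[P PP] (s : R) : exists G : R -> C, forall t, is_cderive G t (g (s +i* t)).
  by exists P.
apply: antiderivative_complex => t.
by apply: continuous_comp; [exact: continuous_vertical|exact: cg].
Qed.

Lemma horizontal_antiderivative (g : C -> C) : continuous g ->
  exists P : R -> R -> C, forall s t, is_cderive (P s) t (g (t +i* s)).
Proof.
move=> cg.
suff /choice[P PP] (s : R) : exists G : R -> C, forall t, is_cderive G t (g (t +i* s)).
  by exists P.
apply: antiderivative_complex => t.
by apply: continuous_comp; [exact: continuous_horizontal|exact: cg].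
Qed.

(** By periodicity the two horizontal sides of a rectangle of height 2 pi carry the same integrand
    and cancel, so Goursat's theorem equates the two vertical integrals. *)
Lemma vertical_integral_const (g : C -> C) (PV : R -> R -> C) (u0 u1 : R) :
  (forall z : C, derivable g z 1) -> (forall w, g (w + 0 +i* (2 * pi)) = g w) ->
  (forall s t, is_cderive (PV s) t (g (s +i* t))) -> u0 <= u1 ->
  PV u1 (2 * pi) - PV u1 0 = PV u0 (2 * pi) - PV u0 0.
Proof.
move=> dg gper dPV u01.
have [PH dPH] := horizontal_antiderivative (derivable_continuous dg).
have pi20 : 0 <= 2 * pi :> R by rewrite mulr_ge0 // pi_ge0.
have W0 : 0 <= u1 - u0 by rewrite subr_ge0.
have := goursat_rect u0 0 dg dPH dPV W0 pi20.
rewrite subrKC add0r /rect_int.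
have -> : PH (2 * pi) u1 - PH (2 * pi) u0 = PH 0 u1 - PH 0 u0.
  apply: (is_cderive_unique (g := fun t => g (t +i* 0))) => t; last exact: dPH.
  have -> : g (t +i* 0) = g (t +i* (2 * pi)).
    rewrite -gper; congr g.
    by apply/eqP; rewrite eq_complex /=; apply/andP; split; apply/eqP; ring.
  exact: dPH.
move=> E; have i0 : ci != 0 :> C by rewrite -normr_eq0 norm_ci oner_eq0.
apply: (mulfI i0); apply: subr0_eq; rewrite -[RHS]E. ring.
Qed.

(* That is, f'(z) is the mean of f (z + e^(it)) e^(-it) over the unit circle.  The
   function g w = f (z + e^w) e^(-w) is entire and 2 pi i-periodic, so by Goursat
   its integral over a vertical period does not depend on Re w; letting Re w tend
   to -oo, the factor e^(-w) turns f (z + e^w) - f z into f'(z). *)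
Lemma cauchy_derivative (f : C -> C) (z : C) (V : R -> C) :
  (forall z : C, derivable f z 1) ->
  (forall t, is_cderive V t (f (z + cexp (0 +i* t)) * cexp (- (0 +i* t)))) ->
  V (2 * pi) - V 0 = (2 * pi)%:C * 'D_1 f z.
Proof.
move=> df dV.
pose g w := f (z + cexp w) * cexp (- w).
have dcexp (w : C) : derivable (@cexp R) w 1 by case: (is_derive_cexp w).
have dg (w : C) : derivable g w 1.
  apply: derivableM.
    have H : is_derive (z + cexp w) 1 f ('D_1 f (z + cexp w)) by exact: derivableP.
    by case: (is_derive_comp1 (g := fun w => z + cexp w) H (is_deriveD (is_derive_cst z w 1) (is_derive_cexp w))).
  by case: (is_derive_comp1 (is_derive_cexp (- w)) (is_deriveNid w 1)).
have gper w : g (w + 0 +i* (2 * pi)) = g w.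
  rewrite /g cexp_2pi_periodic; congr (_ * _).
  by rewrite -[- w](subrK (0 +i* (2 * pi))) cexp_2pi_periodic opprD.
have [PV dPV] := vertical_antiderivative (derivable_continuous dg).
rewrite (is_cderive_unique 0 (2 * pi) dV (dPV 0)).
apply/eqP; rewrite -subr_eq0 -normr_le0; apply/ler_addgt0Pr => _ /pos_real[E E0 ->].
rewrite add0r.
have pi0 : 0 < 2 * pi :> R by rewrite mulr_gt0 // pi_gt0.
(* The mean value inequality costs a factor 2 and the segment has length 2 pi. *)
pose e := E / (2 * (2 * pi)).
have e0 : 0 < e by rewrite divr_gt0 // mulr_gt0.
have e0' : 0 < e%:C :> C by rewrite ltcR.
have dfz : is_derive z 1 f ('D_1 f z) by exact: derivableP.
have /is_derive_epsP /(_ _ e0') /nbhs_ballP[_ /= /pos_real[r r0 ->] rP] := dfz.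
(* This makes u <= 0 and e^u < r: the circle of radius e^u around [z] lies where the first-order
   expansion of [f] has error at most e |h|. *)
pose u := - `|ln r| - 1.
have u0 : u <= 0 by have := normr_ge0 (ln r); rewrite /u; lra.
have ur : expR u < r.
  rewrite -[ltRHS](@lnK _ r) // ltr_expR /u.
  by have := ler_norm (- ln r); rewrite normrN; lra.
rewrite (vertical_integral_const dg gper dPV u0).
(* A primitive of f'(z) + f(z) e^(-w), the first-order part of g. Over a vertical period the term in
   e^(-w) contributes nothing and the linear one contributes 2 pi i f'(z). *)
pose F (w : C) := 'D_1 f z * w - f z * cexp (- w).
have dF (w : C) : is_derive w 1 F ('D_1 f z + f z * cexp (- w)).
  have H := is_derive_comp1 (is_derive_cexp (- w)) (is_deriveNid w 1).
  apply: is_derive_eq.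
  by rewrite /GRing.scale /=; ring.
have H := is_cderive_MVT_le (M := e) (ltW pi0) (fun t => is_cderiveB
      (is_cderiveMl ci (dPV u t)) (is_cderive_vertical (dF (u +i* t)))).
have -> : PV u (2 * pi) - PV u 0 - (2 * pi)%:C * 'D_1 f z =
    - ci * (ci * PV u (2 * pi) - F (u +i* (2 * pi)) - (ci * PV u 0 - F (u +i* 0))).
  rewrite /F.
  have -> : cexp (- (u +i* (2 * pi))) = cexp (- (u +i* 0)).
    rewrite -[LHS]cexp_2pi_periodic; congr cexp.
    by apply/eqP; rewrite eq_complex /=; apply/andP; split; apply/eqP; ring.
  have -> : u +i* (2 * pi) = u +i* 0 + ci * (2 * pi)%:C.
    by apply/eqP; rewrite eq_complex /=; apply/andP; split; apply/eqP; ring.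
  have ii : ci * ci = -1 :> C.
    by apply/eqP; rewrite eq_complex /=; apply/andP; split; apply/eqP; ring.
  transitivity (- (ci * ci) * (PV u (2 * pi) - PV u 0 - (2 * pi)%:C * 'D_1 f z)).
    by rewrite ii opprK mul1r.
  by ring.
rewrite normrM normrN norm_ci mul1r.
apply: le_trans (H _) _; last first.
  rewrite lecR subr0 (_ : 2 * e * (2 * pi) = E) // /e.
  by move: (2 * pi) (lt0r_neq0 pi0) => T T0; field.
move=> t _; rewrite -mulrBr normrM norm_ci mul1r /g.
set w := u +i* t.
have inb : ball (0 : C) r%:C (cexp w).
  by rewrite /ball /= sub0r normrN norm_cexp ltcR.
have := rP _ inb; rewrite /GRing.scale /= => le.
(* With h = e^w, the remainder of size e |h| is multiplied by |e^(-w)| = 1 / |h|, so the bound is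
   [e] whatever [u] is. *)
have -> : f (z + cexp w) * cexp (- w) - ('D_1 f z + f z * cexp (- w)) =
    (f (z + cexp w) - f z - cexp w * 'D_1 f z) * cexp (- w).
  rewrite !mulrBl [cexp w * _]mulrC -mulrA cexpN mulr1; ring.
rewrite normrM; apply: le_trans (ler_wpM2r (normr_ge0 _) le) _.
by rewrite -mulrA -normrM cexpN normr1 mulr1.
Qed.

End CauchyDerivative.

(** * Regularity of the derivative, from its mean value formula *)

Section DerivativeHolomorphic.
Variable R : realType.
Local Notation C := R[i].
Implicit Types (f g : C -> C) (z : C) (t : R).

Definition circ t : C := cexp (0 +i* t).

Lemma norm_cexp_circ t : `|cexp (- (0 +i* t))| = 1 :> C.
Proof. by rewrite norm_cexp /= oppr0 expR0. Qed.

Lemma continuous_cexp : continuous (@cexp R).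
Proof. by apply: derivable_continuous => z; case: (is_derive_cexp z). Qed.

Lemma continuous_circ : continuous circ.
Proof.
by move=> t; apply: continuous_comp; [exact: continuous_vertical|exact: continuous_cexp].
Qed.

Lemma circle_antiderivative g z : continuous g ->
  exists V, forall t, is_cderive V t (g (z + circ t) * cexp (- (0 +i* t))).
Proof.
move=> cg.
have [|V dV] := @vertical_antiderivative R (fun w => g (z + cexp w) * cexp (- w)).
  move=> w; apply: (@cvgM _ _ _ (nbhs_filter w) (fun w => g (z + cexp w))).
    apply: (@continuous_comp _ _ _ (fun w => z + cexp w)); last exact: cg.
    apply: (@continuousD _ _ _ (fun=> z) (@cexp R)).
      exact: cst_continuous.
    exact: continuous_cexp.
  by apply: continuous_comp; [exact: opp_continuous|exact: continuous_cexp].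
by exists (V 0).
Qed.

Lemma circle_bound (V g : R -> C) (M : R) :
  (forall t, is_cderive V t (g t * cexp (- (0 +i* t)))) ->
  (forall t, t \in `[0, 2 * pi]%R -> `|g t| <= M%:C) ->
  `|V (2 * pi) - V 0| <= (2 * pi)%:C * (2 * M)%:C.
Proof.
move=> dV gM; have pi0 : 0 <= 2 * pi :> R by rewrite mulr_ge0 // pi_ge0.
have := is_cderive_MVT_le (M := M) pi0 dV.
rewrite subr0 [2 * M * _]mulrC rmorphM; apply => t t2.
by rewrite normrM norm_cexp_circ mulr1 gM.
Qed.

(** Compactness of the parameter interval: the neighbourhoods of h = 0, which depend on [t], can be
    replaced by a single one. *)
Lemma unif_circle (P : C -> R -> Prop) :
  (forall t, \forall u \near t & h \near (0 : C), P h u) ->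
  \forall h \near (0 : C), forall t, t \in `[0, 2 * pi]%R -> P h t.
Proof.
move=> H.
have /compact_near_coveringP cpt : compact `[0, 2 * pi : R]%classic.
  exact: segment_compact.
have := cpt C (nbhs (0 : C)) P (nbhs_filter _) (fun t _ => H t).
by apply: filterS => h Ph t t2; exact: (Ph t t2).
Qed.

(** Puts the point of the circle and its translate by [h] in one disc around [z + circ t], in the
    joint form in [u] and [h] that [unif_circle] asks for. *)
Lemma near_circle z t (e : R) : 0 < e ->
  \forall u \near t & h \near (0 : C),
    `|(z + circ t) - (z + circ u)| <= e%:C /\ `|(z + circ t) - (z + h + circ u)| <= e%:C.
Proof.
move=> e0.
have e20 : 0 < (e / 2)%:C :> C by rewrite ltcR divr_gt0.
have H1 : \forall u \near t, `|circ t - circ u| <= (e / 2)%:C.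
  by have /(@cvgrPdist_le _ C _ _ (nbhs_filter t)) := @continuous_circ t; apply.
have H2 : \forall h \near (0 : C), `|h| <= (e / 2)%:C by exact: nbhs0_le.
exists ([set u | `|circ t - circ u| <= (e / 2)%:C], [set h | `|h| <= (e / 2)%:C]) => //.
move=> -[u h] /= [tu h0].
have eE : e%:C = (e / 2)%:C + (e / 2)%:C by rewrite -rmorphD /= -splitr.
split; rewrite eE.
  have -> : z + circ t - (z + circ u) = circ t - circ u by ring.
  by apply: le_trans tu _; rewrite lerDl ltW.
have -> : z + circ t - (z + h + circ u) = (circ t - circ u) - h by ring.
by apply: le_trans (ler_normB _ _) _; exact: lerD.
Qed.

Lemma norm_realE z : exists2 r : R, 0 <= r & `|z| = r%:C.
Proof. by rewrite normc_def; eexists; last by []; rewrite sqrtr_ge0. Qed.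

Lemma pi2_gt0 : 0 < (2 * pi : R)%:C :> C.
Proof. by rewrite ltcR mulr_gt0 // pi_gt0. Qed.

Lemma near_continuous g z (e : R) : continuous g -> 0 < e ->
  \forall w \near z, `|g z - g w| <= e%:C.
Proof.
move=> cg e0; have e0' : 0 < e%:C :> C by rewrite ltcR.
by have /(@cvgrPdist_le _ C _ _ (nbhs_filter z)) := @cg z; apply.
Qed.

(** By [cauchy_derivative], f'(z) - f'(w) is a mean of f (z + e^(it)) - f (w + e^(it)) against a
    factor of modulus 1, and this difference is small uniformly in [t]. The tolerance e / 2 absorbs
    the factor 2 of [circle_bound]. *)
Lemma continuous_derivative f : (forall z, derivable f z 1) -> continuous (fun z => 'D_1 f z).
Proof.
move=> df z; apply/(@cvgrPdist_le _ C _ _ (nbhs_filter z)) => _ /pos_real[e e0 ->].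
have cf := derivable_continuous df.
have e20 : 0 < e / 2 by rewrite divr_gt0.
have e40 : 0 < e / 4 by rewrite divr_gt0.
suff H : \forall h \near (0 : C), forall t, t \in `[0, 2 * pi]%R ->
    `|f (z + circ t) - f (z + h + circ t)| <= (e / 2)%:C.
  have [V0 dV0] := circle_antiderivative z cf.
  have near_shift : \forall w \near z, forall t, t \in `[0, 2 * pi]%R ->
      `|f (z + circ t) - f (w + circ t)| <= (e / 2)%:C.
    have /nbhs_ballP[r /= r0 rH] := H; apply/nbhs_ballP; exists r => //= w zw.
    have inb : ball (0 : C) r (w - z) by rewrite /ball /= sub0r opprB.
    by have := rH _ inb; rewrite subrKC.
  apply: filterS near_shift => w wH.
  have [Vw dVw] := circle_antiderivative w cf.
  have dd t : is_cderive (fun t => V0 t - Vw t) t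
      ((f (z + circ t) - f (w + circ t)) * cexp (- (0 +i* t))).
    by rewrite mulrBl; exact: is_cderiveB.
  have := circle_bound dd wH.
  have -> : V0 (2 * pi) - Vw (2 * pi) - (V0 0 - Vw 0) =
      (V0 (2 * pi) - V0 0) - (Vw (2 * pi) - Vw 0) by ring.
  rewrite (cauchy_derivative df dV0) (cauchy_derivative df dVw) -mulrBr normrM.
  rewrite (gtr0_norm pi2_gt0) ler_pM2l ?pi2_gt0 //.
  by rewrite [2 * (e / 2)]mulrC divfK ?pnatr_eq0.
apply: unif_circle => t.
have /nbhs_ballP[_ /= /pos_real[r r0 ->] rH] := near_continuous (z + circ t) cf e40.
have r20 : 0 < r / 2 by rewrite divr_gt0.
have inr w : `|z + circ t - w| <= (r / 2)%:C -> ball (z + circ t) r%:C w.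
  by rewrite /ball /= => /le_lt_trans; apply; rewrite ltcR ltr_pdivrMr // ltr_pMr // ltr1n.
apply: filterS (near_circle z t r20) => -[u h] [/= /inr /rH h1 /inr /rH h2].
have -> : (e / 2)%:C = (e / 4)%:C + (e / 4)%:C by rewrite -rmorphD; congr (_%:C); field.
have -> : f (z + circ u) - f (z + h + circ u) =
   (f (z + circ t) - f (z + h + circ u)) - (f (z + circ t) - f (z + circ u)) by ring.
by apply: le_trans (ler_normB _ _) _; exact: lerD.
Qed.

(** The mean value inequality for v |-> f v - v f'(w0) on the segment from [w] to [w'], along which
    f' stays close to f'(w0). Both endpoints are free, which supplies the uniformity in the base
    point needed by the compactness argument. *)
Lemma strict_derivative f w0 (e : R) : (forall z, derivable f z 1) -> 0 < e ->
  exists2 r : R, 0 < r & forall w w', `|w0 - w| < r%:C -> `|w0 - w'| < r%:C ->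
    `|f w' - f w - (w' - w) * 'D_1 f w0| <= (2 * e)%:C * `|w' - w|.
Proof.
move=> df e0; have cf' := continuous_derivative df.
have /nbhs_ballP[_ /= /pos_real[r r0 ->] rH] := near_continuous w0 cf' e0.
exists r => // w w' wr w'r.
have [d d0 dE] := norm_realE (w' - w).
pose F v := f v - v * 'D_1 f w0.
have dF t : is_cderive (fun t => F (w + t%:C * (w' - w))) t
    ((w' - w) * ('D_1 f (w + t%:C * (w' - w)) - 'D_1 f w0)).
  apply: (@is_cderive_line _ F); set v := w + _.
  have H : is_derive v 1 f ('D_1 f v) by exact: derivableP.
  have K := is_deriveB H (is_deriveM (is_derive_id v 1) (is_derive_cst ('D_1 f w0) v 1)).
  have FE : F = f - id * cst ('D_1 f w0) by [].
  rewrite FE; move: K; move: ('D_1 f v) ('D_1 f w0) => a b K; apply: (is_derive_eq K).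
  by rewrite scaler0 add0r /GRing.scale /= mulr1.
have := is_cderive_MVT_le (M := d * e) (@ler01 R) dF.
have -> : 2 * (d * e) * (1 - 0) = 2 * e * d by ring.
rewrite rmorph1 rmorph0 mul1r mul0r addr0 subrKC dE -rmorphM.
have -> : F w' - F w = f w' - f w - (w' - w) * 'D_1 f w0 by rewrite /F mulrBl; ring.
apply => t; rewrite in_itv /= => /andP[t0 t1].
rewrite normrM dE rmorphM /=; apply: ler_wpM2l; first by rewrite ler0c.
rewrite distrC; apply: rH; rewrite /ball /=.
have -> : w0 - (w + t%:C * (w' - w)) = (1 - t)%:C * (w0 - w) + t%:C * (w0 - w').
  by rewrite rmorphB /= rmorph1; ring.
apply: le_lt_trans (ler_normD _ _) _; rewrite !normrM !normC_real.
rewrite (ger0_norm t0) [`|1 - t|]ger0_norm ?subr_ge0 //.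
have -> : r%:C = (1 - t)%:C * r%:C + t%:C * r%:C by rewrite -mulrDl -rmorphD subrK mul1r.
(* Strictness is taken from the summand with factor [t], so the endpoint t = 0 is treated apart. *)
have [->|tn0] := eqVneq t 0.
  rewrite subr0 rmorph0 rmorph1 !mul0r !addr0 !mul1r. exact: wr.
apply: ler_ltD.
  by apply: ler_wpM2l; [rewrite ler0c subr_ge0|exact: ltW].
by rewrite ltr_pM2l // ltcR lt_neqAle eq_sym tn0.
Qed.

(* Differentiation under the integral in cauchy_derivative, which is legitimate
   because that same formula already gave the continuity of f'. *)
Theorem derivative_derivable f : (forall z, derivable f z 1) ->
  forall z, derivable (fun z => 'D_1 f z) z 1.
Proof.
move=> df z; have cf := derivable_continuous df.
have cf' := continuous_derivative df.
have [U dU] := circle_antiderivative z cf'.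
(* The candidate for f''(z): the mean value formula with f' in place of f. *)
pose L := (U (2 * pi) - U 0) / (2 * pi : R)%:C.
suff : is_derive z 1 (fun z => 'D_1 f z) L by case.
apply/is_derive_epsP => _ /pos_real[e e0 ->].
have e40 : 0 < e / 4 by rewrite divr_gt0.
suff H : \forall h \near (0 : C), forall t, t \in `[0, 2 * pi]%R ->
    `|f (z + h + circ t) - f (z + circ t) - h * 'D_1 f (z + circ t)| <= (e / 2)%:C * `|h|.
  apply: filterS H => h hH.
  have [V0 dV0] := circle_antiderivative z cf.
  have [Vh dVh] := circle_antiderivative (z + h) cf.
  have dd t : is_cderive (fun t => Vh t - V0 t - h * U t) t
    ((f (z + h + circ t) - f (z + circ t) - h * 'D_1 f (z + circ t)) * cexp (- (0 +i* t))).
    rewrite 2!mulrBl -mulrA; apply: is_cderiveB; last exact: is_cderiveMl.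
    exact: is_cderiveB.
  have [d d0 dE] := norm_realE h.
  have := circle_bound (M := e / 2 * d) dd.
  have -> : Vh (2 * pi) - V0 (2 * pi) - h * U (2 * pi) - (Vh 0 - V0 0 - h * U 0) =
      (Vh (2 * pi) - Vh 0) - (V0 (2 * pi) - V0 0) - h * (U (2 * pi) - U 0) by ring.
  rewrite (cauchy_derivative df dV0) (cauchy_derivative df dVh).
  have -> : U (2 * pi) - U 0 = (2 * pi)%:C * L by rewrite /L [RHS]mulrC divfK // gt_eqF // pi2_gt0.
  rewrite [h * (_ * L)]mulrCA -!mulrBr normrM (gtr0_norm pi2_gt0) ler_pM2l ?pi2_gt0 //.
  have -> : 2 * (e / 2 * d) = e * d by field.
  rewrite [(e * d)%:C]rmorphM /= -dE; apply => t t2.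
  by rewrite rmorphM /= -dE; exact: hH.
apply: unif_circle => t.
(* The strict derivative at z + e^(it) costs 2 (e / 8) |h|, and replacing f' there by f' at z +
   e^(iu) costs (e / 8) |h|: in all 3 e / 8 <= e / 2. *)
have e80 : 0 < e / 8 by rewrite divr_gt0.
have [r r0 rH] := strict_derivative (z + circ t) df e80.
have /nbhs_ballP[_ /= /pos_real[r' r'0 ->] rH'] := near_continuous (z + circ t) cf' e80.
pose m := Num.min r r'; have m0 : 0 < m by rewrite lt_min r0.
have m20 : 0 < m / 2 by rewrite divr_gt0.
have inm w : `|z + circ t - w| <= (m / 2)%:C -> `|z + circ t - w| < m%:C.
  by move/le_lt_trans; apply; rewrite ltcR ltr_pdivrMr // ltr_pMr // ltr1n.
have inr w : `|z + circ t - w| < m%:C -> `|z + circ t - w| < r%:C.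
  by move/lt_le_trans; apply; rewrite lecR ge_min lexx.
have inr' w : `|z + circ t - w| < m%:C -> ball (z + circ t) r'%:C w.
  by rewrite /ball /= => /lt_le_trans; apply; rewrite lecR ge_min lexx orbT.
apply: filterS (near_circle z t m20) => -[u h] [/= /inm h1 /inm h2].
have := rH _ _ (inr _ h1) (inr _ h2).
have -> : z + h + circ u - (z + circ u) = h by ring.
have : `|'D_1 f (z + circ t) - 'D_1 f (z + circ u)| <= (e / 8)%:C := rH' _ (inr' _ h1).
move: ('D_1 f (z + circ t)) ('D_1 f (z + circ u)) => a b le2 le1.
have -> : f (z + h + circ u) - f (z + circ u) - h * b =
  (f (z + h + circ u) - f (z + circ u) - h * a) + h * (a - b) by ring.
apply: le_trans (ler_normD _ _) _.
apply: (@le_trans _ _ ((2 * (e / 8))%:C * `|h| + (e / 8)%:C * `|h|)).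
  by apply: lerD => //; rewrite normrM mulrC; apply: ler_wpM2r.
rewrite -mulrDl -rmorphD /=; apply: ler_wpM2r; rewrite // lecR; lra.
Qed.

End DerivativeHolomorphic.

(** * Flows of the polynomial fields *)

Section Flows.
Variable R : realType.
Local Notation C := R[i].

Lemma is_derive_eq_fun (f g : C -> C) (z df dg : C) :
  is_derive z 1 f df -> f = g -> df = dg -> is_derive z 1 g dg.
Proof. by move=> + <- <-. Qed.

Lemma is_derive_horner (p : {poly C}) (x : C) : is_derive x 1 (horner p) p^`().[x].
Proof.
elim/poly_ind: p => [|p c IH].
  rewrite deriv0 horner0; apply: (is_derive_eq_fun (is_derive_cst 0 x 1)) => //.
  by apply/funext => y; rewrite horner0.
apply: (is_derive_eq_fun (is_deriveD (is_deriveM IH (is_derive_id x 1)) (is_derive_cst c x 1))).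
  by apply/funext => y; rewrite !hornerE.
by rewrite derivD derivM derivX derivC !hornerE /GRing.scale /=; ring.
Qed.

Lemma poly_antiderivative (p : {poly C}) : exists q : {poly C}, q^`() = p.
Proof.
exists (\sum_(i < size p) (p`_i / i.+1%:R) *: 'X^(i.+1)).
rewrite raddf_sum /= -[RHS]coefK poly_def; apply: eq_bigr => i _.
by rewrite derivZ derivXn /= -scalerMnr scalerMnl -mulr_natr divfK ?pnatr_eq0.
Qed.

Lemma is_derive_cexp_comp (G : C -> C) (z g : C) : is_derive z 1 G g ->
  is_derive z 1 (fun w => cexp (G w)) (g * cexp (G z)).
Proof. by move=> dG; exact: (is_derive_comp1 (is_derive_cexp (G z)) dG). Qed.

Lemma is_deriveMl_fun (c : C) (G : C -> C) (z g : C) : is_derive z 1 G g ->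
  is_derive z 1 (fun w => c * G w) (c * g).
Proof. by move=> dG; exact: is_deriveZ. Qed.

Lemma cexpX (z : C) n : cexp z ^+ n = cexp (n%:R * z).
Proof.
elim: n => [|n IH]; first by rewrite expr0 mul0r cexp0.
by rewrite exprS IH -cexpD -natr1 mulrDl mul1r addrC.
Qed.

Lemma normalize_antiderivative (G g : C -> C) : (forall z : C, is_derive z 1 G (g z)) ->
  exists2 H : C -> C, H 0 = 0 & forall z : C, is_derive z 1 H (g z).
Proof.
move=> dG; exists (fun z => G z - G 0) => [|z]; first by rewrite subrr.
apply: (is_derive_eq_fun (is_deriveB (dG z) (is_derive_cst (G 0) z 1))) => //.
by rewrite subr0.
Qed.

Lemma poly_affine_antiderivative (A : {poly C}) (x b : C) :
  exists2 G : C -> C, G 0 = 0 & forall z : C, is_derive z 1 G A.[x + b * z].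
Proof.
have [q qA] := poly_antiderivative (A \Po (x%:P + b *: 'X)).
apply: (normalize_antiderivative (G := horner q)) => z.
apply: (is_derive_eq_fun (is_derive_horner q z)) => //.
by rewrite qA horner_comp !hornerE.
Qed.

(** For a nonzero [a], write the integrand as B(e^(az)) with B = p X + c. The constant term
    integrates to c z, and the rest to q(e^(az)) / a with q' = p, since the factor X supplies the
    inner derivative. Coefficients along the flows of both families have this form. *)
Lemma poly_exp_antiderivative (A : {poly C}) (al be a : C) :
  exists2 G : C -> C, G 0 = 0 & forall z : C, is_derive z 1 G A.[al * cexp (a * z) + be].
Proof.
have [->|a0] := eqVneq a 0.
  have [G G0 dG] := poly_affine_antiderivative A (al + be) 0.
  exists G => // z; apply: (is_derive_eq_fun (dG z)) => //.
  by rewrite !mul0r addr0 cexp0 mulr1.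
suff [G dG] : exists G : C -> C, forall z : C, is_derive z 1 G (A \Po (al *: 'X + be%:P)).[cexp (a * z)].
  have [H H0 dH] := normalize_antiderivative dG; exists H => // z.
  by apply: (is_derive_eq_fun (dH z)) => //; rewrite horner_comp !hornerE.
elim/poly_ind: (A \Po _) => [|p c _].
  by exists (cst 0) => z; rewrite horner0; exact: is_derive_cst.
have [q qp] := poly_antiderivative p.
exists (fun z => c * z + a^-1 * q.[cexp (a * z)]) => z.
have dE := is_derive_cexp_comp (is_deriveMl_fun a (is_derive_id z 1)).
have dq := is_derive_comp1 (g := fun w => cexp (a * w)) (is_derive_horner q _) dE.
apply: (is_derive_eq_fun (is_deriveD (is_deriveMl_fun c (is_derive_id z 1))
  (is_deriveMl_fun a^-1 dq))) => //.
rewrite qp !hornerE /GRing.scale /=.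
by field.
Qed.

(** The system is triangular: x solves an affine equation by itself, and then y is y0 times the
    exponential of a primitive of A(x(z)). *)
Lemma flow_i (a b : C) (A : {poly C}) (p : C * C) : exists x y : C -> C,
  [/\ x 0 = p.1, y 0 = p.2,
   forall z : C, is_derive z 1 x (field_i a b A (x z, y z)).1 &
   forall z : C, is_derive z 1 y (field_i a b A (x z, y z)).2].
Proof.
case: p => x0 y0 /=.
suff [x [x0E dx [G G0 dG]]] : exists x : C -> C, [/\ x 0 = x0,
    forall z : C, is_derive z 1 x (a * x z + b) &
    exists2 G : C -> C, G 0 = 0 & forall z : C, is_derive z 1 G A.[x z]].
  exists x, (fun z => y0 * cexp (G z)); split => //.
    by rewrite G0 cexp0 mulr1.
  move=> z; apply: (is_derive_eq_fun (is_deriveMl_fun y0 (is_derive_cexp_comp (dG z)))) => //.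
  by rewrite mulrCA.
have [->|a0] := eqVneq a 0.
  exists (fun z => x0 + b * z); split; first by rewrite mulr0 addr0.
    move=> z; apply: (is_derive_eq_fun (is_deriveD (is_derive_cst x0 z 1)
      (is_deriveMl_fun b (is_derive_id z 1)))) => //.
    by rewrite mul0r !add0r mulr1.
  exact: poly_affine_antiderivative.
(* For a nonzero [a] the affine equation is linear around its fixed point -b/a. *)
exists (fun z => (x0 + b / a) * cexp (a * z) + (- (b / a))); split.
- by rewrite mulr0 cexp0 mulr1 addrK.
- move=> z; have dE := is_derive_cexp_comp (is_deriveMl_fun a (is_derive_id z 1)).
  apply: (is_derive_eq_fun (is_deriveD (is_deriveMl_fun (x0 + b / a) dE)
     (is_derive_cst (- (b / a)) z 1))) => //.
  by move: (cexp _) => v; field.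
- exact: poly_exp_antiderivative.
Qed.

(* The monomial x^m t^n evolves by d/dz (x^m t^n) = n a x^m t^n, so the coefficient
   A(x^m t^n) is an explicit function of the time. *)
Lemma flow_ii (a : C) (m n : nat) (A : {poly C}) (p : C * C) : exists x y : C -> C,
  [/\ x 0 = p.1, y 0 = p.2,
   forall z : C, is_derive z 1 x (field_ii a m n A (x z, y z)).1 &
   forall z : C, is_derive z 1 y (field_ii a m n A (x z, y z)).2].
Proof.
case: p => x0 y0 /=.
have [G G0 dG] := poly_exp_antiderivative A (x0 ^+ m * y0 ^+ n) 0 (n%:R * a).
pose x z := x0 * cexp (n%:R * G z).
pose y z := y0 * cexp (a * z - m%:R * G z).
(* [G] was built from the predicted value of the monomial; the prediction is confirmed because the
   terms m n G in the two exponents cancel. *)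
have xy z : x z ^+ m * y z ^+ n = x0 ^+ m * y0 ^+ n * cexp (n%:R * a * z) + 0.
  rewrite addr0 /x /y exprMn [(y0 * _) ^+ n]exprMn !cexpX mulrACA -cexpD; congr (_ * cexp _); ring.
exists x, y; split.
- by rewrite /x G0 mulr0 cexp0 mulr1.
- by rewrite /y G0 !mulr0 subrr cexp0 mulr1.
- move=> z; rewrite xy.
  apply: (is_derive_eq_fun (is_deriveMl_fun x0 (is_derive_cexp_comp (is_deriveMl_fun n%:R (dG z))))) => //.
  by rewrite /x /=; ring.
- move=> z; rewrite xy.
  apply: (is_derive_eq_fun (is_deriveMl_fun y0 (is_derive_cexp_comp
    (is_deriveB (is_deriveMl_fun a (is_derive_id z 1)) (is_deriveMl_fun m%:R (dG z)))))) => //.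
  by rewrite /y /=; ring.
Qed.

End Flows.

(** * Straightening the graph *)

Section Shear.
Variable R : realType.
Local Notation C := R[i].
Local Notation C2 := (C * C)%type.

Lemma is_diff_fst (p : C2) : is_diff p (@fst C C) (@fst C C).
Proof.
have cfst : continuous (@fst C C) by move=> q; exact: cvg_fst.
apply: DiffDef; first exact: linear_differentiable.
by rewrite diff_lin.
Qed.

Lemma is_diff_snd (p : C2) : is_diff p (@snd C C) (@snd C C).
Proof.
have csnd : continuous (@snd C C) by move=> q; exact: cvg_snd.
apply: DiffDef; first exact: linear_differentiable.
by rewrite diff_lin.
Qed.

Lemma is_derive_pair (f g : C -> C) (z df dg : C) :
  is_derive z 1 f df -> is_derive z 1 g dg ->
  is_derive z 1 (fun w => (f w, g w)) (df, dg).
Proof.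
move=> [/derivable1_diffP Df <-] [/derivable1_diffP Dg <-].
have Dfg := differentiable_pair Df Dg.
apply: DeriveDef; first exact/derivable1_diffP.
by rewrite (deriveE _ Dfg) diff_pair // (deriveE _ Df) (deriveE _ Dg).
Qed.

Variable s : C -> C.
Hypothesis ds : forall z : C, derivable s z 1.

Lemma is_diff_comp_fst (p : C2) :
  is_diff p (fun q : C2 => s q.1) (fun v : C2 => v.1 * 'D_1 s p.1).
Proof.
have Ds : differentiable s p.1 by apply/derivable1_diffP.
have [Df fE] := is_diff_fst p.
apply: DiffDef; first exact: differentiable_comp.
rewrite (@diff_comp _ _ _ _ (@fst C C)) // fE; apply/funext => v /=.
by rewrite -[X in 'd s _ X]mulr1 linearZ -(deriveE _ Ds).
Qed.

Lemma is_diff_shear (c : C) (p : C2) :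
  is_diff p (fun q : C2 => q.2 + c * s q.1) (fun v : C2 => v.2 + c * (v.1 * 'D_1 s p.1)).
Proof. exact: is_diffD (is_diff_snd p) (is_diffZ c (is_diff_comp_fst p)). Qed.

(** The parameter treats the straightening (c = -1) and its inverse (c = 1) together. *)
Definition shear (c : C) (q : C2) : C2 := (q.1, q.2 + c * s q.1).

Lemma diff_shear (c : C) (p : C2) :
  differentiable (shear c) p /\
  'd (shear c) p = (fun v : C2 => (v.1, v.2 + c * (v.1 * 'D_1 s p.1))) :> (C2 -> C2).
Proof.
have [D1 E1] := is_diff_fst p; have [D2 E2] := is_diff_shear c p.
split; first exact: differentiable_pair.
apply: etrans (diff_pair D1 D2) _.
apply/funext => v; exact: (congr2 pair (congr1 (@^~ v) E1) (congr1 (@^~ v) E2)).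
Qed.

Lemma shearK (c : C) : cancel (shear c) (shear (- c)).
Proof. by case=> z w; rewrite /shear /= mulNr addrK. Qed.

Lemma holomorphic_shear (c : C) : holomorphic (shear c).
Proof. by move=> p; case: (diff_shear c p). Qed.

Lemma shearKN : cancel (shear (- 1)) (shear 1).
Proof. by move=> p; rewrite -[X in shear X](opprK 1) shearK. Qed.

Definition straighten : automorphism R :=
  Automorphism (holomorphic_shear (- 1)) (holomorphic_shear 1) shearKN (shearK 1).

Lemma fiber_preserving_straighten : fiber_preserving straighten.
Proof.
move=> z; exists z; apply/seteqP; split=> [_ [p <- <-] //|p pz].
by exists (shear 1 p); [exact: pz|exact: (shearK 1)].
Qed.

Lemma straighten_graph : aut_fun straighten @` graph_of s `<=` [set p | p.2 = 0].
Proof. by move=> _ [p ps <-] /=; rewrite ps mulN1r subrr. Qed.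

(** The differential of the inverse shear applied to [X1] at the straightened point; as the first
    coordinate is preserved, s' is taken at [p.1]. *)
Definition pullback (X1 : vector_field R) : vector_field R := fun p =>
  let v := X1 (straighten p) in (v.1, v.2 + v.1 * 'D_1 s p.1).

Lemma pushforward_pullback (X1 : vector_field R) :
  vf_pushforward straighten (pullback X1) = X1.
Proof.
apply/funext => q; rewrite /vf_pushforward.
have [_ ->] := diff_shear (- 1) (aut_inv straighten q).
rewrite /pullback aut_invK /= mulN1r addrK.
by case: (X1 q).
Qed.

Lemma holomorphic_pullback (X1 : vector_field R) : holomorphic X1 -> holomorphic (pullback X1).
Proof.
move=> hX p; pose v q := X1 (straighten q).
have dv : differentiable v p.
  by apply: (@differentiable_comp _ _ _ _ (shear (- 1))); [exact: holomorphic_shear|exact: hX].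
have dv1 : differentiable (fun q => (v q).1) p.
  by apply: (@differentiable_comp _ _ _ _ v (@fst C C)); [exact: dv|case: (is_diff_fst (v p))].
have dv2 : differentiable (fun q => (v q).2) p.
  by apply: (@differentiable_comp _ _ _ _ v (@snd C C)); [exact: dv|case: (is_diff_snd (v p))].
have ds' : differentiable (fun q : C2 => 'D_1 s q.1) p.
  apply: (@differentiable_comp _ _ _ _ (@fst C C) (fun z => 'D_1 s z)); first by case: (is_diff_fst p).
  by apply/derivable1_diffP; exact: derivative_derivable.
apply: differentiable_pair; first exact: dv1.
by apply: differentiableD; [exact: dv2|exact: differentiableM].
Qed.

(** The inverse shear carries entire solutions to entire solutions; the chain rule for s (x z)
    produces exactly the term in s'. *)
Lemma complete_pullback (X1 : vector_field R) :
  (forall p : C2, exists x y : C -> C,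
    [/\ x 0 = p.1, y 0 = p.2,
     forall z : C, is_derive z 1 x (X1 (x z, y z)).1 &
     forall z : C, is_derive z 1 y (X1 (x z, y z)).2]) ->
  complete_vf (pullback X1).
Proof.
move=> flow p; have [x [y [x0 y0 dx dy]]] := flow (straighten p).
exists (fun z => (x z, y z + s (x z))); split.
  by rewrite x0 y0 /= mulN1r subrK -surjective_pairing.
move=> z; rewrite /pullback.
have -> : straighten (x z, y z + s (x z)) = (x z, y z).
  by rewrite /= /shear /= mulN1r addrK.
have dsx : is_derive (x z) 1 s ('D_1 s (x z)) by exact: derivableP.
exact: (is_derive_pair (dx z) (is_deriveD (dy z) (is_derive_comp1 dsx (dx z)))).
Qed.

Lemma tangent_pullback (X1 : vector_field R) :
  (forall x, (X1 (x, 0)).2 = 0) -> tangent_to (pullback X1) (graph_of s).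
Proof.
move=> X0 p [f [Dp _ _ _]].
have d0 q := is_diff_shear (- 1) q.
(* The global equation w - s(z) replaces the given local one: it has derivative 1 along (0, 1), and
   on the pulled-back field its differential is the second component of [X1] at a point of {t =
   0}. *)
exists (fun q => q.2 + (- 1) * s q.1); split; first split => //.
- by near=> q; case: (d0 q).
- exists (0, 1); case: (d0 p) => _ ->.
  by rewrite /= mul0r mulr0 addr0 oner_neq0.
- by near=> q; rewrite mulN1r; split=> [->|/subr0_eq //]; rewrite subrr.
have E : straighten p = (p.1, 0) by rewrite /= /shear (Dp : p.2 = s p.1) mulN1r subrr.
by case: (d0 p) => _ ->; rewrite /pullback E /= X0 add0r mulN1r subrr.
Unshelve. all: by end_near. Qed.

End Shear.

(** * Holomorphy of the polynomial fields, and the theorem *)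

Section Fields.
Variable R : realType.
Local Notation C := R[i].
Local Notation C2 := (C * C)%type.

Lemma differentiable_horner_comp (A : {poly C}) (f : C2 -> C) (p : C2) :
  differentiable f p -> differentiable (fun q => A.[f q]) p.
Proof.
move=> df; apply: differentiable_comp; first exact: df.
by apply/derivable1_diffP; case: (is_derive_horner A (f p)).
Qed.

Lemma differentiable_fst (p : C2) : differentiable (@fst C C) p.
Proof. by case: (is_diff_fst p). Qed.

Lemma differentiable_snd (p : C2) : differentiable (@snd C C) p.
Proof. by case: (is_diff_snd p). Qed.

Lemma holomorphic_field_i (a b : C) (A : {poly C}) : holomorphic (field_i a b A).
Proof.
move=> p.
have -> : field_i a b A = fun q => (a * q.1 + b, A.[q.1] * q.2) by apply/funext => -[].
apply: differentiable_pair.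
  apply: differentiableD; last exact: differentiable_cst.
  by apply: differentiableM; [exact: differentiable_cst|exact: differentiable_fst].
apply: differentiableM; last exact: differentiable_snd.
by apply: differentiable_horner_comp; exact: differentiable_fst.
Qed.

Lemma holomorphic_field_ii (a : C) (m n : nat) (A : {poly C}) :
  holomorphic (field_ii a m n A).
Proof.
move=> p; pose c (q : C2) := A.[q.1 ^+ m * q.2 ^+ n].
have -> : field_ii a m n A =
    fun q => (c q * (n%:R * q.1), a * q.2 - c q * (m%:R * q.2)) by apply/funext => -[].
have dX k (f : C2 -> C) : differentiable f p -> differentiable (fun q => f q ^+ k) p.
  rewrite (_ : (fun q => f q ^+ k) = fun q => ('X^k).[f q]).
    exact: differentiable_horner_comp.
  by apply/funext => q; rewrite hornerXn.
have dc : differentiable c p.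
  apply: differentiable_horner_comp; apply: differentiableM; apply: dX.
    exact: differentiable_fst.
  exact: differentiable_snd.
have cM (k : C) (f : C2 -> C) : differentiable f p -> differentiable (fun q => k * f q) p.
  by move=> df; apply: differentiableM => //; exact: differentiable_cst.
apply: differentiable_pair.
  by apply: differentiableM => //; apply: cM; exact: differentiable_fst.
apply: differentiableB; first by apply: cM; exact: differentiable_snd.
by apply: differentiableM => //; apply: cM; exact: differentiable_snd.
Qed.

End Fields.

Theorem proposition4 (R : realType) (s : R[i] -> R[i]) (hs : holomorphic s) :
  forall X1 : vector_field R, family_i X1 \/ family_ii X1 ->
  exists X : vector_field R,
    [/\ holomorphic X, complete_vf X, tangent_to X (graph_of s) &
      exists Phi : automorphism R,
        [/\ fiber_preserving Phi,
            aut_fun Phi @` graph_of s `<=` [set p | p.2 = 0] &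
            vf_pushforward Phi X = X1]].
Proof.
have ds (z : R[i]) : derivable s z 1 by apply/derivable1_diffP; exact: hs.
move=> X1 X1E.
suff [hX flow X0] : [/\ holomorphic X1,
    forall p : R[i] * R[i], exists x y : R[i] -> R[i],
      [/\ x 0 = p.1, y 0 = p.2,
       forall z : R[i], is_derive z 1 x (X1 (x z, y z)).1 &
       forall z : R[i], is_derive z 1 y (X1 (x z, y z)).2] &
    forall x, (X1 (x, 0)).2 = 0].
  exists (pullback ds X1); split.
  - exact: holomorphic_pullback.
  - exact: complete_pullback.
  - exact: tangent_pullback.
  exists (straighten ds); split.
  - exact: fiber_preserving_straighten.
  - exact: straighten_graph.
  - exact: pushforward_pullback.
case: X1E => [[a [b [A [_ ->]]]]|[a [m [n [A [_ _ _ _ ->]]]]]]; split.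
- exact: holomorphic_field_i.
- exact: flow_i.
- by move=> x /=; rewrite mulr0.
- exact: holomorphic_field_ii.
- exact: flow_ii.
- by move=> x /=; rewrite !mulr0 subr0.
Qed.
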